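(* Let $n$ be a positive integer. Then the following congruence holds modulo $\Phi_n(q)^2$: $$\sum_{k=0}^{n-1}q^{k}C_k(q)\equiv\begin{cases}-q^{\frac{n^2-1}{3}}-q^{\frac{n(2n-1)}{3}} & \text{if } n\equiv 2\pmod 3,\\[5pt] q^{\frac{n^2-1}{3}}-\frac{n-1}{3}(q^n-1) & \text{if } n\equiv 1\pmod 3.\end{cases}$$ (No assertion is made when $n\equiv 0\pmod 3$.)
   Context: Here $q$ is an indeterminate. The $q$-shifted factorial is $(a;q)_m=(1-a)(1-aq)\cdots(1-aq^{m-1})$ for $m\ge 1$ and $(a;q)_0=1$. The $q$-binomial coefficient is $\left[{m\atop k}\right]=\frac{(q;q)_m}{(q;q)_k(q;q)_{m-k}}$ if $0\le k\le m$, and $0$ otherwise; it is a polynomial in $q$ with integer coefficients. The $q$-integer is $[m]_q=\frac{1-q^m}{1-q}$. The $q$-Catalan numbers are the polynomials $C_k(q)=\frac{1}{[k+1]_q}\left[{2k\atop k}\right]=\left[{2k\atop k}\right]-q\left[{2k\atop k+1}\right]\in\mathbb{Z}[q]$. $\Phi_n(q)=\prod_{1\le j\le n,\ \gcd(n,j)=1}(q-e^{2\pi i j/n})$ is the $n$th cyclotomic polynomial. The congruence is between polynomials in $\mathbb{Z}[q]$: $A(q)\equiv B(q)\pmod{\Phi_n(q)^2}$ means that $\Phi_n(q)^2$ divides $A(q)-B(q)$ in $\mathbb{Z}[q]$ (equivalently in $\mathbb{Q}[q]$, as $\Phi_n$ is monic). *)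

(* Defs.v *)
From mathcomp Require Import all_boot all_order all_algebra all_field.
From mathcomp Require Import ring.

Set Implicit Arguments.
Unset Strict Implicit.
Unset Printing Implicit Defensive.

Import GRing.Theory.
Local Open Scope ring_scope.

(* The indeterminate q is 'X : {poly int}.  The quotients below use polydiv's
   %/ on {poly int}; every divisor has leading coefficient 1 or -1, so this is
   genuine Euclidean division, and qbinom_def, qint_def, qcatalan_def show that
   each quotient is exact. *)

Definition qpoch (a : {poly int}) (m : nat) : {poly int} :=
  \prod_(i < m) (1 - a * 'X^i).

Definition qbinom (m k : nat) : {poly int} :=
  if (k <= m)%N then qpoch 'X m %/ (qpoch 'X k * qpoch 'X (m - k)) else 0.

Definition qint (m : nat) : {poly int} := (1 - 'X^m) %/ (1 - 'X).

Definition qcatalan (k : nat) : {poly int} := qbinom k.*2 k %/ qint k.+1.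

Definition eqpmod (d a b : {poly int}) : Prop :=
  exists r : {poly int}, a - b = r * d.

Lemma qpochS a m : qpoch a m.+1 = qpoch a m * (1 - a * 'X^m).
Proof. by rewrite /qpoch big_ord_recr. Qed.

Lemma lead_coef_1subXn m : lead_coef (1 - 'X^(m.+1) : {poly int}) = -1.
Proof.
rewrite -opprB lead_coefN; congr (- _).
by apply/monicP; rewrite -polyC1 monicXnsubC.
Qed.

Lemma lead_coef_qpoch m : lead_coef (qpoch 'X m) \in GRing.unit.
Proof.
elim: m => [|m IH]; first by rewrite /qpoch big_ord0 lead_coef1 unitr1.
by rewrite qpochS lead_coefM unitrM IH -exprS lead_coef_1subXn.
Qed.

Lemma qint_sum m : qint m = \sum_(i < m) 'X^i.
Proof.
rewrite /qint -opprB subrX1 -mulNr opprB Pdiv.IdomainUnit.mulKp //.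
by rewrite -['X]expr1 lead_coef_1subXn.
Qed.

Lemma qint_def m : qint m * (1 - 'X) = 1 - 'X^m.
Proof. by rewrite qint_sum mulrC -[RHS]opprB subrX1 -mulNr opprB. Qed.

Lemma qintS m : qint m.+1 = 1 + 'X * qint m.
Proof.
rewrite !qint_sum big_ord_recl expr0 mulr_sumr; congr (_ + _).
by apply: eq_bigr => i _; rewrite -exprS.
Qed.

Lemma lead_coef_qint m : lead_coef (qint m.+1) \in GRing.unit.
Proof.
have := congr1 lead_coef (qint_def m.+1).
rewrite lead_coefM -{1}['X]expr1 !lead_coef_1subXn => e.
have : lead_coef (qint m.+1) * (-1) \in GRing.unit by rewrite e.
by rewrite unitrM => /andP[].
Qed.

Lemma qpoch_dvd m k : exists g : {poly int},
  qpoch 'X (m + k) = g * (qpoch 'X m * qpoch 'X k).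
Proof.
have [s] := ubnP (m + k); elim: s m k => // s IH [|m] [|k] les.
- by exists 1; rewrite /qpoch !big_ord0 !mulr1.
- by exists 1; rewrite add0n {2}/qpoch big_ord0 !mul1r.
- by exists 1; rewrite addn0 {3}/qpoch big_ord0 mul1r mulr1.
have [g Eg] := IH m k.+1 ltac:(by []).
have [h Eh] := IH m.+1 k ltac:(by rewrite -addSnnS in les).
exists (g + 'X^(m.+1) * h); rewrite addSn qpochS.
have -> : 1 - 'X * 'X^(m + k.+1) =
  (1 - 'X * 'X^m) + 'X^(m.+1) * (1 - 'X * 'X^k) :> {poly int}.
  rewrite mulrBr mulr1 -!exprS -exprD addrA subrK.
  by rewrite addSn.
rewrite mulrDr {1}Eg -addSnnS Eh mulrDl !(qpochS 'X m) !(qpochS 'X k).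
ring.
Qed.

Lemma qbinom_def m k : (k <= m)%N ->
  qbinom m k * (qpoch 'X k * qpoch 'X (m - k)) = qpoch 'X m.
Proof.
move=> lekm; have [g] := qpoch_dvd k (m - k); rewrite subnKC // => Eg.
rewrite /qbinom lekm Eg Pdiv.IdomainUnit.mulpK //.
by rewrite lead_coefM unitrM !lead_coef_qpoch.
Qed.

Lemma qpoch_neq0 m : qpoch 'X m != 0.
Proof.
rewrite -lead_coef_eq0; apply: contraTneq (lead_coef_qpoch m) => ->.
by rewrite unitr0.
Qed.

Lemma qbinom_mid k :
  qbinom k.*2 k.+1 * qint k.+1 = qbinom k.*2 k * qint k.
Proof.
case: k => [|k]; first by rewrite [qint 0]qint_sum big_ord0 /qbinom mul0r mulr0.
have h1 := @qbinom_def k.+1.*2 k.+1 ltac:(by rewrite -addnn leq_addr).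
have h2 := @qbinom_def k.+1.*2 k.+2 ltac:(by rewrite doubleS !ltnS -addnn leq_addr).
have e1 : (k.+1.*2 - k.+1 = k.+1)%N by rewrite -addnn addnK.
have e2 : (k.+1.*2 - k.+2 = k)%N by rewrite subnS e1.
have nzX : 1 - 'X != 0 :> {poly int}.
  by rewrite -lead_coef_eq0 -['X]expr1 lead_coef_1subXn.
have nz : (1 - 'X) * (qpoch 'X k.+1 * qpoch 'X k) != 0.
  by rewrite !mulf_neq0 ?qpoch_neq0.
apply: (mulIf nz).
rewrite !mulrA -![_ * qint _ * _]mulrA !qint_def.
move: h1 h2; rewrite e1 e2 => h1 h2.
have F : 1 - 'X^(k.+1) = 1 - 'X * 'X^k :> {poly int} by rewrite exprS.
transitivity (qpoch 'X k.+1.*2).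
  by rewrite -h2 (qpochS 'X k.+1) -exprS; ring.
by rewrite -h1 F {2}qpochS; ring.
Qed.

Lemma qcatalanE k : qcatalan k = qbinom k.*2 k - 'X * qbinom k.*2 k.+1.
Proof.
set c := RHS; have E : qbinom k.*2 k = c * qint k.+1.
  rewrite /c mulrBl -mulrA qbinom_mid qintS mulrDr mulr1.
  by rewrite [qbinom _ _ * ('X * _)]mulrCA addrK.
by rewrite /qcatalan E Pdiv.IdomainUnit.mulpK // lead_coef_qint.
Qed.

Lemma qcatalan_def k : qcatalan k * qint k.+1 = qbinom k.*2 k.
Proof.
rewrite qcatalanE mulrBl -mulrA qbinom_mid qintS mulrDr mulr1.
by rewrite [qbinom _ _ * ('X * _)]mulrCA addrK.
Qed.

(* Main.v *)
(* Put B(j) = qbinom (2n) (n + j).  With the generalised pentagonal exponents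
   f_c(j) = j(3j+2c+1)/2, the alternating sums
     P_c(m) = sum_j (-1)^j q^f_c(j) qbinom m (ceil((m + 3j + c) / 2))
   satisfy P_c(m+1) - P_c(m) = (a single term), because the corrections produced
   by the q-Pascal rules telescope in j.  At m = 2n this gives
     P_1 = sum_k q^k [2k, k],        q^2 P_3 = sum_k q^(k+1) [2k, k+1],
     [2n, n] = 1 + q^2 P_3 + q P_2   (Schur's finite pentagonal identity),
   so the q-Catalan sum is P_1 - q^2 P_3.
   Modulo Phi_n^2 the q-Vandermonde formula yields B(j) = 2 qbinom n j for
   0 < j < n, which is invariant under j -> n - j, while qbinom n j is divisible
   by Phi_n, so that powers of q in front of it only matter modulo n.  Under this
   reflection one of P_2, P_3 is opposite to itself, hence reduces to its boundary
   term, and P_1 is exchanged with the other one; [2n, n] = 1 + q^(n^2) then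
   determines everything. *)

Require Import Defs.
From mathcomp Require Import all_boot all_order all_algebra all_field.
From mathcomp Require Import ring zify.

Set Implicit Arguments.
Unset Strict Implicit.
Unset Printing Implicit Defensive.

Import GRing.Theory.
Local Open Scope ring_scope.

(** * Pascal rules and the q-Vandermonde formula *)

Lemma qbinom_small m k : (m < k)%N -> qbinom m k = 0.
Proof. by rewrite /qbinom ltnNge; case: leqP. Qed.

Lemma qpoch0 a : qpoch a 0 = 1.
Proof. by rewrite /qpoch big_ord0. Qed.

Lemma qbinom0 m : qbinom m 0 = 1.
Proof.
apply: (mulIf (qpoch_neq0 m)); rewrite mul1r -[RHS](qbinom_def (leq0n m)).
by rewrite qpoch0 mul1r subn0.
Qed.

Lemma qbinom_sym m k : (k <= m)%N -> qbinom m (m - k) = qbinom m k.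
Proof. by move=> le_km; rewrite /qbinom leq_subr subKn // le_km mulrC. Qed.

Lemma qbinomn m : qbinom m m = 1.
Proof. by rewrite -(qbinom0 m) -(qbinom_sym (leq0n m)) subn0. Qed.

Lemma qbinom_pascal m k :
  qbinom m.+1 k.+1 = qbinom m k + 'X^(k.+1) * qbinom m k.+1.
Proof.
have [lt_mk|lt_km|->] := ltngtP m k.
- by rewrite !qbinom_small ?mulr0 ?addr0 // ltnW.
- have [d E] : exists d, (m = k + d.+1)%N by exists (m - k.+1)%N; lia.
  have /= h0 := @qbinom_def m.+1 k.+1 (ltnW lt_km).
  have /= h1 := @qbinom_def m k (ltnW lt_km).
  have /= h2 := @qbinom_def m k.+1 lt_km.
  have e1 : (m - k = d.+1)%N by lia.
  have e2 : (m - k.+1 = d)%N by lia.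
  rewrite subSS e1 in h0; rewrite e1 in h1; rewrite e2 in h2.
  have nz : qpoch 'X k.+1 * qpoch 'X d.+1 != 0 by rewrite mulf_neq0 ?qpoch_neq0.
  apply: (mulIf nz); rewrite h0 mulrDl.
  (* With denominators cleared, this is 1 - q^(m+1) = (1 - q^(k+1)) + q^(k+1) (1 - q^(d+1)). *)
  transitivity (qpoch 'X m * (1 - 'X * 'X^k) +
      'X^(k.+1) * (qpoch 'X m * (1 - 'X * 'X^d))); last first.
    by rewrite -{1}h1 -h2 !(qpochS 'X k) !(qpochS 'X d); ring.
  have -> : qpoch 'X m.+1 = qpoch 'X m * (1 - 'X * ('X^k * ('X * 'X^d))).
    by rewrite qpochS {2}E exprD exprS.
  by rewrite exprS; ring.
- by rewrite !qbinomn (@qbinom_small k k.+1) // mulr0 addr0.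
Qed.

Lemma qbinom_pascal_compl m k :
  qbinom m.+1 k.+1 = 'X^(m - k) * qbinom m k + qbinom m k.+1.
Proof.
have [lt_mk|lt_km|->] := ltngtP m k.
- by rewrite !qbinom_small ?mulr0 ?addr0 // ltnW.
- rewrite -(@qbinom_sym m.+1 k.+1) 1?ltnW // subSS.
  rewrite -(@qbinom_sym m k) 1?ltnW // -(@qbinom_sym m k.+1) //.
  by rewrite subnS; case: (m - k)%N (subn_gt0 k m) => [|d _];
     rewrite ?lt_km // qbinom_pascal addrC.
- by rewrite !qbinomn (@qbinom_small k k.+1) // subnn expr0 mulr1 addr0.
Qed.

Lemma qVandermonde m n k :
  qbinom (m + n) k =
  \sum_(i < k.+1) qbinom m i * qbinom n (k - i) * 'X^((m - i) * (k - i)).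
Proof.
elim: m k => [|m IH] [|k].
- by rewrite big_ord1 !qbinom0 !mul1r.
- rewrite big_ord_recl big1 => [|i _]; last by rewrite qbinom_small ?mul0r.
  by rewrite qbinom0 /= mul1r mulr1 addr0.
- by rewrite big_ord1 !qbinom0 muln0 !mulr1.
rewrite addSn qbinom_pascal !IH [in RHS]big_ord_recl.
rewrite [in X in _ + _ * X]big_ord_recl mulrDr addrCA; congr (_ + _).
  by rewrite !qbinom0 !subn0 mulSn exprD; ring.
rewrite mulr_sumr -big_split; apply: eq_bigr => i _ /=.
rewrite /bump /= add1n !subSS qbinom_pascal 2!mulrDl; congr (_ + _).
(* For i >= m the factor [qbinom m i.+1] is zero; otherwise the truncated m - (i+1) is a true
   difference. *)
have [lt_mi|lt_im] := ltnP i m; last by rewrite qbinom_small // !(mulr0, mul0r).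
have -> : 'X^((m - i) * (k - i)) =
    'X^((m - i.+1) * (k - i)) * 'X^(k - i) :> {poly int}.
  by rewrite -exprD; congr ('X^_); nia.
have -> : 'X^(k.+1) = 'X^(i.+1) * 'X^(k - i) :> {poly int}.
  by rewrite -exprD; congr ('X^_); have := ltn_ord i; lia.
by ring.
Qed.

(** * Telescoping of the alternating pentagonal sums *)

Definition pent c j := (3 * 'C(j, 2) + (c + 2) * j)%N.

Lemma pentS c j : pent c j.+1 = (pent c j + 3 * j + c + 2)%N.
Proof. by rewrite /pent binS bin1; ring. Qed.

Lemma double_pent c j : ((pent c j).*2 = j * (3 * j + 2 * c + 1))%N.
Proof.
elim: j => [|j IH]; first by rewrite /pent muln0.
rewrite pentS; move: (pent c j) IH => p IH.
by rewrite -!addnA doubleD IH -!mul2n; ring.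
Qed.

(* Writing the lower index as m - floor((m - 3j - c) / 2) makes the terms outside
   the support vanish without any condition on truncated subtraction. *)
Definition pterm c m j : {poly int} :=
  (-1) ^+ j * 'X^(pent c j) * qbinom m (m + 3 * j + c + 1)./2.

(** [J] only cuts off P_c(m): the terms with 3j + c > m are zero. *)
Definition psum c J m := \sum_(j < J) pterm c m j.

(* The telescoping correction shared by the terms j and j.+1 when m is increased. *)
Definition plink c m j : {poly int} :=
  if odd (m + 3 * j + c) then 0 else
  (-1) ^+ j * 'X^(pent c j + (m + 3 * j + c + 2)./2)
    * qbinom m (m + 3 * j + c + 2)./2.

(** The correction that would link j = 0 to j = -1; having no partner, it survives the
    telescoping. *)
Definition pgap c m : {poly int} :=
  if odd (m + c) then 'X^(m - (m + c)./2) * qbinom m (m + c)./2 else 0.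

Lemma pterm_step_even c m j : ~~ odd (m + 3 * j + c) ->
  pterm c m.+1 j = pterm c m j + plink c m j.
Proof.
move=> ev; rewrite /plink (negPf ev) /pterm.
have -> : ((m.+1 + 3 * j + c + 1)./2 = ((m + 3 * j + c)./2).+1)%N by lia.
have -> : ((m + 3 * j + c + 1)./2 = (m + 3 * j + c)./2)%N by lia.
have -> : ((m + 3 * j + c + 2)./2 = ((m + 3 * j + c)./2).+1)%N by lia.
by rewrite qbinom_pascal exprD; ring.
Qed.

Lemma pterm_step_odd c m j : odd (m + 3 * j.+1 + c) ->
  pterm c m.+1 j.+1 = pterm c m j.+1 - plink c m j.
Proof.
move=> od; have /negPf ev : ~~ odd (m + 3 * j + c) by lia.
rewrite /plink ev /pterm.
set K := ((m + 3 * j + c + 2)./2)%N.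
have -> : ((m.+1 + 3 * j.+1 + c + 1)./2 = K.+1)%N by rewrite /K; lia.
have -> : ((m + 3 * j.+1 + c + 1)./2 = K.+1)%N by rewrite /K; lia.
rewrite qbinom_pascal_compl.
have [lt_mK|le_Km] := ltnP m K; first by rewrite !(qbinom_small lt_mK); ring.
(* The increment 3j + c + 2 of [pent] equals 2K - m, so the correction at j+1 is opposite to the one
   at j. *)
have -> : (pent c j + K = pent c j.+1 + (m - K))%N by rewrite pentS /K; lia.
by rewrite exprD exprS; ring.
Qed.

(** By parity one of the two links is always zero; keeping both makes the sum over j telescope. *)
Lemma pterm_step c m j :
  pterm c m.+1 j.+1 - pterm c m j.+1 = plink c m j.+1 - plink c m j.
Proof.
have [od|ev] := boolP (odd (m + 3 * j.+1 + c)).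
  by rewrite pterm_step_odd // {2}/plink od; ring.
rewrite pterm_step_even // [plink c m j]/plink ifT; last by lia.
by ring.
Qed.

Lemma pterm_step0 c m :
  pterm c m.+1 0 - pterm c m 0 = plink c m 0 + pgap c m.
Proof.
rewrite /pgap; have [od|ev] := boolP (odd (m + c)); last first.
  by rewrite pterm_step_even ?muln0 ?addn0 //; ring.
rewrite /plink muln0 addn0 od /pterm muln0 !addn0.
have -> : ((m.+1 + c + 1)./2 = ((m + c)./2).+1)%N by lia.
have -> : ((m + c + 1)./2 = ((m + c)./2).+1)%N by lia.
by rewrite qbinom_pascal_compl /pent muln0; ring.
Qed.

Lemma psum_step c J m : (m + 3 <= 3 * J + c)%N -> (0 < J)%N ->
  psum c J m.+1 = psum c J m + pgap c m.
Proof.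
case: J => // J leJ _; apply/eqP; rewrite -subr_eq0 opprD addrA; apply/eqP.
rewrite /psum -sumrB big_ord_recl pterm_step0 addrAC addrK.
rewrite (eq_bigr (fun i : 'I_J => plink c m i.+1 - plink c m i)); last first.
  by move=> i _; rewrite -pterm_step.
rewrite -(big_mkord xpredT (fun i => plink c m i.+1 - plink c m i)).
rewrite telescope_sumr // addrC subrK /plink; case: ifP => // _.
(* The bound on [J] puts the lower index of the last link above m. *)
by rewrite qbinom_small ?mulr0 //; lia.
Qed.

Lemma psum0 c J : (0 < c)%N -> psum c J 0 = 0.
Proof.
move=> c_gt0; rewrite /psum big1 // => j _; rewrite /pterm qbinom_small ?mulr0 //.
by lia.
Qed.

(** Steps are taken in pairs because only the one of parity opposite to c contributes. *)
Lemma psum_double c J n : (2 * n + 2 <= 3 * J + c)%N -> (0 < J)%N -> (0 < c)%N ->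
  psum c J (2 * n) = \sum_(k < n) (pgap c (2 * k) + pgap c (2 * k).+1).
Proof.
move=> + J_gt0 c_gt0; elim: n => [|n IH] leJ; first by rewrite big_ord0 psum0.
have -> : (2 * n.+1 = (2 * n).+2)%N by lia.
rewrite !psum_step //; try lia.
by rewrite big_ord_recr /= IH ?addrA //; lia.
Qed.

Lemma psum1_double J n : (2 * n + 1 <= 3 * J)%N -> (0 < J)%N ->
  psum 1 J (2 * n) = \sum_(k < n) 'X^k * qbinom (2 * k) k.
Proof.
move=> leJ J_gt0; rewrite psum_double //; last by lia.
apply: eq_bigr => k _; rewrite /pgap ifT; last by lia.
rewrite ifF ?addr0; last by lia.
by congr ('X^_ * qbinom _ _); lia.
Qed.

Lemma psum3_double J n : (2 * n <= 3 * J + 1)%N -> (0 < J)%N ->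
  'X^2 * psum 3 J (2 * n) = \sum_(k < n) 'X^(k.+1) * qbinom (2 * k) k.+1.
Proof.
move=> leJ J_gt0; rewrite psum_double //; last by lia.
(* At k = 0 the difference 2k - (k+1) truncates, but the q-binomials on both sides vanish. *)
rewrite mulr_sumr; apply: eq_bigr => -[[|k] /= _] _; rewrite /pgap.
  by rewrite !qbinom_small // !(mulr0, addr0).
rewrite ifT; last by lia.
rewrite ifF ?addr0; last by lia.
by rewrite mulrA -exprD; congr ('X^_ * qbinom _ _); lia.
Qed.

Lemma psum2_double J n : (2 * n <= 3 * J)%N -> (0 < J)%N ->
  'X * psum 2 J (2 * n) = \sum_(k < n) 'X^(k.+1) * qbinom (2 * k).+1 k.+1.
Proof.
move=> leJ J_gt0; rewrite psum_double //; last by lia.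
rewrite mulr_sumr; apply: eq_bigr => k _; rewrite /pgap.
rewrite ifF; last by lia.
rewrite ifT ?add0r; last by lia.
by rewrite mulrA -exprS; congr ('X^_ * qbinom _ _); lia.
Qed.

(** Two Pascal steps lead from [2n, n] to [2n+2, n+1]; the sums are q^2 P_3 and q P_2. *)
Lemma qbinom_central_sum n :
  qbinom (2 * n) n = 1 + \sum_(k < n) ('X^(k.+1) * qbinom (2 * k) k.+1)
                       + \sum_(k < n) ('X^(k.+1) * qbinom (2 * k).+1 k.+1).
Proof.
elim: n => [|n IH]; first by rewrite !big_ord0 qbinom0 !addr0.
rewrite !big_ord_recr /= -[RHS]/(1 + (_ + _) + (_ + _)).
have -> : (2 * n.+1 = (2 * n).+2)%N by lia.
rewrite qbinom_pascal_compl -(@qbinom_sym _ n); last by lia.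
have -> : ((2 * n).+1 - n = n.+1)%N by lia.
by rewrite {2}qbinom_pascal IH; ring.
Qed.

(** * Congruences modulo a polynomial *)

Lemma eqpmod_refl d a : eqpmod d a a.
Proof. by exists 0; rewrite subrr mul0r. Qed.

Lemma eqpmod_sym d a b : eqpmod d a b -> eqpmod d b a.
Proof. by case=> r E; exists (- r); rewrite mulNr -E opprB. Qed.

Lemma eqpmod_trans d b a c : eqpmod d a b -> eqpmod d b c -> eqpmod d a c.
Proof. by case=> r Er [s Es]; exists (r + s); rewrite mulrDl -Er -Es subrKA. Qed.

Lemma eqpmodD d a b a' b' :
  eqpmod d a a' -> eqpmod d b b' -> eqpmod d (a + b) (a' + b').
Proof. by case=> r Er [s Es]; exists (r + s); rewrite mulrDl -Er -Es; ring. Qed.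

Lemma eqpmodN d a b : eqpmod d a b -> eqpmod d (- a) (- b).
Proof. by case=> r E; exists (- r); rewrite mulNr -E; ring. Qed.

Lemma eqpmodB d a b a' b' :
  eqpmod d a a' -> eqpmod d b b' -> eqpmod d (a - b) (a' - b').
Proof. by move=> Ea /eqpmodN; apply: eqpmodD. Qed.

Lemma eqpmodMl d c a b : eqpmod d a b -> eqpmod d (c * a) (c * b).
Proof. by case=> r E; exists (c * r); rewrite -mulrA -E mulrBr. Qed.

Lemma eqpmod_sum d (I : Type) (s : seq I) (P : pred I) (F G : I -> {poly int}) :
  (forall i, P i -> eqpmod d (F i) (G i)) ->
  eqpmod d (\sum_(i <- s | P i) F i) (\sum_(i <- s | P i) G i).
Proof.
move=> FG; elim/big_rec2: _ => [|i x y Pi]; first exact: eqpmod_refl.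
by apply: eqpmodD; apply: FG.
Qed.

Lemma eqpmod_sum0 d (I : Type) (s : seq I) (P : pred I) (F : I -> {poly int}) :
  (forall i, P i -> eqpmod d (F i) 0) -> eqpmod d (\sum_(i <- s | P i) F i) 0.
Proof. 
move=> F0; apply: (eqpmod_trans (eqpmod_sum s (G := fun=> 0) F0)).
by rewrite big1 //; apply: eqpmod_refl.
 Qed.

Lemma eqpmodMl0 d c a : eqpmod d a 0 -> eqpmod d (c * a) 0.
Proof. by move=> /(eqpmodMl c); rewrite mulr0. Qed.

(** * Divisibility by Phi_n, and reductions modulo its square *)

Lemma Cyclotomic_dvd n (z : algC) (p : {poly int}) :
  n.-primitive_root z -> root (map_poly intr p) z -> eqpmod 'Phi_n p 0.
Proof.
move=> prim_z; have [m [Em _] dvd_m] := minCpolyP z.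
have intrC (q : {poly int}) :
    map_poly (intr : int -> algC) q = map_poly ratr (map_poly (intr : int -> rat) q).
  by rewrite -map_poly_comp; apply: eq_map_poly => c /=; rewrite ratr_int.
have -> : map_poly intr p = map_poly ratr (map_poly (intr : int -> rat) p) :> {poly algC}.
  exact: intrC.
have Phi_m : m = map_poly intr 'Phi_n.
  apply: (map_poly_inj (@ratr algC)); rewrite -intrC -Em.
  by rewrite (minCpoly_cyclotomic prim_z) (Cintr_Cyclotomic prim_z).
(* Phi_n is the minimal polynomial of z over Q; being monic, hence primitive, it also divides p over
   Z. *)
rewrite dvd_m Phi_m dvdp_rat_int => /dvdpP_int[r ->].
by exists r; rewrite subr0 (zprimitive_monic (Cyclotomic_monic n)) mulrC.
Qed.

Section Cyclotomic.

Variable n : nat.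
Hypothesis n_gt0 : (0 < n)%N.

Lemma Cyclotomic_dvd_Xn_sub1 : eqpmod 'Phi_n ('X^n - 1) 0.
Proof.
have [z prim_z] := C_prim_root_exists n_gt0.
apply: (Cyclotomic_dvd prim_z); rewrite rmorphB rmorph1 /= map_polyXn.
by rewrite rootE !hornerE (prim_expr_order prim_z) subrr.
Qed.

(** At a primitive n-th root of unity (q;q)_n vanishes, while (q;q)_k and (q;q)_(n-k) do not. *)
Lemma Cyclotomic_dvd_qbinom k : (0 < k < n)%N -> eqpmod 'Phi_n (qbinom n k) 0.
Proof.
case/andP=> k_gt0 lt_kn; have [z prim_z] := C_prim_root_exists n_gt0.
apply: (Cyclotomic_dvd prim_z).
have evE m : (map_poly intr (qpoch 'X m)).[z] = \prod_(i < m) (1 - z ^+ i.+1).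
  rewrite /qpoch rmorph_prod horner_prod; apply: eq_bigr => i _.
  by rewrite -exprS rmorphB rmorph1 /= map_polyXn !hornerE.
have ev_neq0 m : (m < n)%N -> (map_poly intr (qpoch 'X m)).[z] != 0.
  move=> lt_mn; rewrite evE; apply/prodf_neq0 => i _.
  rewrite subr_eq0 eq_sym -(prim_order_dvd prim_z).
  by rewrite gtnNdvd //; have := ltn_ord i; lia.
have ev_n : (map_poly intr (qpoch 'X n)).[z] == 0.
  have lt_pn : (n.-1 < n)%N by rewrite prednK.
  rewrite evE (bigD1 (Ordinal lt_pn)) //= prednK //.
  by rewrite (prim_expr_order prim_z) subrr mul0r.
move: ev_n; rewrite -(qbinom_def (ltnW lt_kn)) !rmorphM /= !hornerM.
by rewrite !mulf_eq0 (negPf (ev_neq0 _ lt_kn)) (negPf (ev_neq0 _ _)) ?orbF //; lia.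
Qed.

Lemma eqpmod_sqr_mul0 a b :
  eqpmod 'Phi_n a 0 -> eqpmod 'Phi_n b 0 -> eqpmod ('Phi_n ^+ 2) (a * b) 0.
Proof.
case=> r + [s]; rewrite !subr0 => -> ->.
by exists (r * s); rewrite subr0 expr2; ring.
Qed.

Lemma expXn_sub1 a : eqpmod 'Phi_n ('X^(n * a) - 1) 0.
Proof.
have [r] := Cyclotomic_dvd_Xn_sub1; rewrite subr0 => E.
by rewrite exprM subrX1 E -mulrA mulrC; eexists; rewrite subr0 -mulrA mulrC.
Qed.

(** First-order expansion of (1 + u)^a for u = q^n - 1, as Phi_n^2 divides u^2. *)
Lemma expXn_linear a :
  eqpmod ('Phi_n ^+ 2) 'X^(n * a) (1 + a%:R * ('X^n - 1)).
Proof.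
elim: a => [|a IH]; first by rewrite muln0 mul0r addr0; apply: eqpmod_refl.
have -> : 'X^(n * a.+1) = 'X^(n * a) + 'X^(n * a) * ('X^n - 1) :> {poly int}.
  by rewrite mulnS exprD; ring.
have -> : 1 + a.+1%:R * ('X^n - 1) =
    (1 + a%:R * ('X^n - 1)) + ('X^n - 1) :> {poly int} by rewrite mulrS; ring.
apply: eqpmodD => //.
have [r] := eqpmod_sqr_mul0 (expXn_sub1 a) Cyclotomic_dvd_Xn_sub1.
by rewrite subr0 => E; exists r; rewrite -E; ring.
Qed.

(** [g] brings one factor Phi_n and q^(nw) - 1 the other; [x] and [y] express that a and b agree
    modulo n without leaving the natural numbers. *)
Lemma eqpmod_expXn a b (g : {poly int}) x y : (a + n * x = b + n * y)%N ->
  eqpmod 'Phi_n g 0 -> eqpmod ('Phi_n ^+ 2) ('X^a * g) ('X^b * g).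
Proof.
move=> Eab g0.
have shift c w : eqpmod ('Phi_n ^+ 2) ('X^(c + n * w) * g) ('X^c * g).
  have [r] := eqpmod_sqr_mul0 (expXn_sub1 w) g0; rewrite subr0 => E.
  by exists ('X^c * r); rewrite -mulrA -E exprD; ring.
apply: eqpmod_trans (eqpmod_sym (shift a x)) _; rewrite Eab; exact: shift.
Qed.

(** In q-Vandermonde the inner terms contain two q-binomials divisible by Phi_n; the two outer terms
    both reduce to [qbinom n k]. *)
Lemma qbinom_double_mod k : (0 < k < n)%N ->
  eqpmod ('Phi_n ^+ 2) (qbinom (2 * n) k) (qbinom n k *+ 2).
Proof.
case: k => // k /andP[_ lt_kn]; have g0 := @Cyclotomic_dvd_qbinom k.+1 lt_kn.
rewrite mul2n -addnn qVandermonde big_ord_recl big_ord_recr /= !subn0 !qbinom0.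
rewrite /bump /= add1n subnn qbinom0 muln0 mul1r !mulr1 addrC mulr2n addrC.
apply: eqpmodD.
  rewrite mulrC -[X in eqpmod _ _ X]mul1r -(expr0 'X).
  by apply: (@eqpmod_expXn _ _ _ 0%N k.+1) => //; rewrite muln0 addn0 add0n.
rewrite addrC -[X in eqpmod _ _ X]addr0; apply: eqpmodD; first exact: eqpmod_refl.
apply: eqpmod_sum0 => i _.
rewrite mulrC; apply: eqpmodMl0.
by apply: eqpmod_sqr_mul0; apply: Cyclotomic_dvd_qbinom; have := ltn_ord i; lia.
Qed.

Lemma qbinom_double_central_mod :
  eqpmod ('Phi_n ^+ 2) (qbinom (2 * n) n) (1 + 'X^(n * n)).
Proof.
have := (eqpmod_sqr_mul0, Cyclotomic_dvd_qbinom).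
rewrite mul2n -addnn qVandermonde; case: n n_gt0 => // m _ [sqr0 dvd_qbinom].
rewrite big_ord_recl big_ord_recr /= !subn0 /bump /= !add1n subnn.
rewrite !qbinom0 !qbinomn muln0 !mul1r.
rewrite expr0 [1 + 'X^_]addrC; apply: eqpmodD; first exact: eqpmod_refl.
rewrite -[X in eqpmod _ _ X]add0r; apply: eqpmodD; last exact: eqpmod_refl.
apply: eqpmod_sum0 => i _; rewrite mulrC; apply: eqpmodMl0.
by apply: sqr0; apply: dvd_qbinom; have := ltn_ord i; lia.
Qed.

(** * Reflection of the sums reduced modulo Phi_n^2 *)

Definition gterm c j : {poly int} :=
  (-1) ^+ j * 'X^(pent c j) * qbinom n (3 * j + c + 1)./2.

Definition gsum c L := \sum_(j < L) gterm c j.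

(** With p = (3j+c+1)/2 rounded down, symmetry turns the lower index n + p into n - p, which lies
    strictly between 0 and n. *)
Lemma pterm_mod c j : (0 < c)%N -> ((3 * j + c + 1)./2 < n)%N ->
  eqpmod ('Phi_n ^+ 2) (pterm c (2 * n) j) (gterm c j *+ 2).
Proof.
move=> c_gt0 lt_pn; rewrite /pterm /gterm -[X in eqpmod _ _ X]mulrnAr.
apply: eqpmodMl.
rewrite -qbinom_sym; last by lia.
rewrite -(@qbinom_sym n); last by lia.
have -> : (2 * n - (2 * n + 3 * j + c + 1)./2 = n - (3 * j + c + 1)./2)%N by lia.
by apply: qbinom_double_mod; lia.
Qed.

Lemma psum_mod c L : (0 < c)%N -> ((3 * L + c < 2 * n + 2)%N) ->
  eqpmod ('Phi_n ^+ 2) (psum c L (2 * n)) (gsum c L *+ 2).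
Proof.
move=> c_gt0 leL; rewrite /gsum -sumrMnl; apply: eqpmod_sum => j _.
by apply: pterm_mod => //; have := ltn_ord j; lia.
Qed.

(** Reversing j -> L - 1 - j turns the lower index p into n - p, which leaves the q-binomial
    unchanged. Up to the shift [e], exponents need only agree modulo n. The reversal costs the sign
    (-1)^(L-1). *)
Lemma gsum_reflect c c' e L (x y : nat -> nat) : (0 < c)%N -> (0 < c')%N ->
  (forall j, j < L ->
     (3 * j + c + 1)./2 + (3 * (L - j.+1) + c' + 1)./2 = n)%N ->
  (forall j, j < L ->
     pent c j + n * x j = e + pent c' (L - j.+1) + n * y j)%N ->
  eqpmod ('Phi_n ^+ 2) (gsum c L) ((-1) ^+ L.+1 * 'X^e * gsum c' L).
Proof.
move=> c_gt0 c'_gt0 Ep Ef; rewrite /gsum mulr_sumr.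
rewrite [X in eqpmod _ _ X](reindex_inj rev_ord_inj) /=.
apply: eqpmod_sum => -[j lt_jL] _ /=.
rewrite /gterm; have := Ep _ lt_jL; have := Ef _ lt_jL; set j' := (L - j.+1)%N.
set p := (_ + c + 1)./2; set p' := (_ + c' + 1)./2 => Efj Epj.
have -> : qbinom n p' = qbinom n p.
  by rewrite -(@qbinom_sym n p'); [congr qbinom|]; lia.
have -> : (-1) ^+ L.+1 * 'X^e * ((-1) ^+ j' * 'X^(pent c' j') * qbinom n p) =
    (-1) ^+ j * ('X^(e + pent c' j') * qbinom n p) :> {poly int}.
  have -> : (-1) ^+ L.+1 = (-1) ^+ j * (-1) ^+ j' :> {poly int}.
    by rewrite -exprD -signr_odd -[RHS]signr_odd; congr (_ ^+ _); rewrite /j'; lia.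
  transitivity ((-1) ^+ j * ((-1) ^+ j' * (-1) ^+ j') *
      ('X^e * 'X^(pent c' j') * qbinom n p) : {poly int}); first by ring.
  by rewrite -expr2 sqrr_sign mulr1 exprD.
rewrite -mulrA; apply/eqpmodMl/(eqpmod_expXn Efj)/Cyclotomic_dvd_qbinom.
by rewrite /p; move: Epj; rewrite /p'; lia.
Qed.

End Cyclotomic.

(** * Boundary terms and the evaluation of P_1, P_2 and P_3 *)

Lemma psum_edge c n L : ((3 * L + c + 1)./2 = n)%N ->
  psum c L.+1 (2 * n) = psum c L (2 * n) + (-1) ^+ L * 'X^(pent c L).
Proof.
move=> En; rewrite {1}/psum big_ord_recr /= {2}/pterm.
have -> : ((2 * n + 3 * L + c + 1)./2 = 2 * n)%N by lia.
by rewrite qbinomn mulr1.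
Qed.

Lemma psum_beyond c n L : (n < (3 * L + c + 1)./2)%N ->
  psum c L.+1 (2 * n) = psum c L (2 * n).
Proof.
move=> lt_n; rewrite {1}/psum big_ord_recr /= {2}/pterm.
by rewrite qbinom_small ?mulr0 ?addr0 //; lia.
Qed.

Lemma sum_qcatalan J n : (2 * n + 1 <= 3 * J)%N -> (0 < J)%N ->
  \sum_(k < n) 'X^k * qcatalan k = psum 1 J (2 * n) - 'X^2 * psum 3 J (2 * n).
Proof.
move=> leJ J_gt0; rewrite psum1_double // psum3_double -?sumrB //; last by lia.
by apply: eq_bigr => k _; rewrite qcatalanE mul2n exprS; ring.
Qed.

Lemma psum_central n J : (0 < n)%N -> (2 * n <= 3 * J)%N -> (0 < J)%N ->
  eqpmod ('Phi_n ^+ 2)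
    ('X^2 * psum 3 J (2 * n) + 'X * psum 2 J (2 * n)) 'X^(n * n).
Proof.
move=> n_gt0 leJ J_gt0; rewrite psum3_double ?psum2_double //; last by lia.
have [r] := qbinom_double_central_mod n_gt0; rewrite qbinom_central_sum => E.
by exists r; rewrite -E; ring.
Qed.

(** Exponent condition of [gsum_reflect] for P_(c+1) reflected into itself: L = j + j' + 1 and e =
    0. *)
Lemma pent_swap c n j j' : (2 * n = 3 * (j + j').+1 + 2 * c)%N ->
  (pent c.+1 j + n * j' = pent c.+1 j' + n * j)%N.
Proof.
move=> En; move: (double_pent c.+1 j) (double_pent c.+1 j').
by move: (pent c.+1 j) (pent c.+1 j') => p p'; nia.
Qed.

(** The same condition for exchanging P_1 with P_(w+1), where e = [pent 1 L + w]. *)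
Lemma pent_cross w n j j' : (2 * n = 3 * (j + j').+1 + w)%N ->
  (pent 1 j + n * (2 * j'.+1) = pent 1 (j + j').+1 + w + pent w.+1 j')%N.
Proof.
move=> En; move: (double_pent 1 j) (double_pent 1 (j + j').+1) (double_pent w.+1 j').
by move: (pent 1 j) (pent 1 (j + j').+1) (pent w.+1 j') => p p0 p'; nia.
Qed.

(** For even L the reflection makes [gsum] opposite to itself; since [psum] reduces to twice [gsum],
    no division by two is required. *)
Lemma psum_self_reflect n c L : (0 < n)%N -> ~~ odd L ->
  (2 * n = 3 * L + 2 * c)%N ->
  eqpmod ('Phi_n ^+ 2) (psum c.+1 L (2 * n)) 0.
Proof.
move=> n_gt0 evL En.
have [] := @gsum_reflect n n_gt0 c.+1 c.+1 0 L (fun j => L - j.+1)%N id => //.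
- by move=> j lt_jL; lia.
- move=> j lt_jL; rewrite add0n; apply: pent_swap.
  by have -> : ((j + (L - j.+1)).+1 = L)%N by lia.
move=> r; rewrite -signr_odd /= evL /= => E.
have leL : (3 * L + c.+1 < 2 * n + 2)%N by lia.
apply: (eqpmod_trans (psum_mod n_gt0 (ltn0Sn c) leL)).
by exists r; rewrite -E mulr2n; ring.
Qed.

(** At j = L the sum P_1 has its boundary term while P_(w+1) has a zero term; all smaller j are
    exchanged by the reflection. *)
Lemma psum_cross_reflect n w L : (0 < n)%N -> (0 < w <= 2)%N -> odd L = odd w ->
  (2 * n = 3 * L + w)%N ->
  eqpmod ('Phi_n ^+ 2) (psum 1 L.+1 (2 * n))
    ((-1) ^+ L * 'X^(pent 1 L) * (1 - 'X^w * psum w.+1 L.+1 (2 * n))).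
Proof.
move=> n_gt0 lew2 oddL En.
rewrite psum_edge ?psum_beyond //; try lia.
have refl : eqpmod ('Phi_n ^+ 2) (gsum n 1 L)
    ((-1) ^+ L.+1 * 'X^(pent 1 L + w) * gsum n w.+1 L).
  apply: (@gsum_reflect n n_gt0 _ _ _ _ (fun j => 2 * (L - j.+1).+1)%N (fun=> 0%N)) => //.
    by move=> j lt_jL; lia.
  move=> j lt_jL; rewrite muln0 addn0.
  have EL : ((j + (L - j.+1)).+1 = L)%N by lia.
  by have := @pent_cross w n j (L - j.+1); rewrite EL; apply.
have le1 : (3 * L + 1 < 2 * n + 2)%N by lia.
have lew : (3 * L + w.+1 < 2 * n + 2)%N by lia.
have [r0 E0] := psum_mod n_gt0 (ltn0Sn 0) le1.
have [rw Ew] := psum_mod n_gt0 (ltn0Sn w) lew.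
have [r E] := refl.
set s := (-1) ^+ L.+1 * 'X^_ in E; exists (r0 + r *+ 2 - s * rw).
transitivity ((psum 1 L (2 * n) - gsum n 1 L *+ 2)
    + (gsum n 1 L - s * gsum n w.+1 L) *+ 2
    - s * (psum w.+1 L (2 * n) - gsum n w.+1 L *+ 2)).
  by rewrite /s exprD exprS; ring.
by rewrite E0 E Ew; ring.
Qed.

(** With u = q^n - 1, (1 + ku)(1 - ku) = 1 - k^2 u^2 and Phi_n^2 divides u^2. *)
Lemma expXn_cancel n g k : (0 < n)%N ->
  eqpmod ('Phi_n ^+ 2) ('X^(g + n * k) * (1 - k%:R * ('X^n - 1))) 'X^g.
Proof.
move=> n_gt0; have [r E] := expXn_linear n_gt0 k.
have u0 := Cyclotomic_dvd_Xn_sub1 n_gt0.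
have [s] := eqpmod_sqr_mul0 u0 u0; rewrite subr0 => Es.
exists ('X^g * (r * (1 - k%:R * ('X^n - 1)) - k%:R ^+ 2 * s)).
have EX : 'X^(n * k) = r * 'Phi_n ^+ 2 + 1 + k%:R * ('X^n - 1) :> {poly int}.
  by rewrite -E; ring.
rewrite exprD EX.
transitivity ('X^g * (r * 'Phi_n ^+ 2 * (1 - k%:R * ('X^n - 1))
    - k%:R ^+ 2 * (('X^n - 1) * ('X^n - 1)))); first by ring.
by rewrite Es; ring.
Qed.

(** The factor 1 - k(q^n - 1) left by the exchange lowers the boundary exponent by nk. *)
Lemma sum_qcatalan_mod n w L k g :
  (0 < n)%N -> (0 < w <= 2)%N -> odd L = odd w -> (2 * n = 3 * L + w)%N ->
  eqpmod ('Phi_n ^+ 2)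
    ('X^w * psum w.+1 L.+1 (2 * n)) (k%:R * ('X^n - 1)) ->
  pent 1 L = (g + n * k)%N ->
  eqpmod ('Phi_n ^+ 2) (psum 1 L.+1 (2 * n)) ((-1) ^+ L * 'X^g).
Proof.
move=> n_gt0 lew2 oddL En ET Eg.
apply: (eqpmod_trans (psum_cross_reflect n_gt0 lew2 oddL En)).
rewrite -mulrA; apply: eqpmodMl; apply: eqpmod_trans (expXn_cancel _ _ n_gt0).
by rewrite Eg; apply/eqpmodMl/eqpmodB => //; apply: eqpmod_refl.
Qed.

Lemma eqpmod_expXn_diff n a b k t t' : (0 < n)%N ->
  eqpmod ('Phi_n ^+ 2) (t + t') 'X^(n * a) ->
  eqpmod ('Phi_n ^+ 2) t' 'X^(n * b) -> a = (b + k)%N ->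
  eqpmod ('Phi_n ^+ 2) t (k%:R * ('X^n - 1)).
Proof.
move=> n_gt0 Ett' Et' Eabk.
have := eqpmod_trans Ett' (expXn_linear n_gt0 a).
move=> /eqpmodB/(_ (eqpmod_trans Et' (expXn_linear n_gt0 b))).
by rewrite addrK Eabk natrD => -[r E]; exists r; rewrite -E; ring.
Qed.

(** * The two residue classes modulo 3 *)

Lemma sum_qcatalan_2mod3 m (n := (3 * m + 2)%N) :
  eqpmod ('Phi_n ^+ 2) (\sum_(k < n) 'X^k * qcatalan k)
    (- 'X^(3 * m ^ 2 + 4 * m + 1) - 'X^(n * (2 * m + 1))).
Proof.
have n_gt0 : (0 < n)%N by rewrite /n; lia.
rewrite (@sum_qcatalan (2 * m).+2); [|rewrite /n; lia|by []].
have S3 : eqpmod ('Phi_n ^+ 2)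
    ('X^2 * psum 3 (2 * m).+2 (2 * n)) 'X^(n * (2 * m + 1)).
  have -> : (n * (2 * m + 1) = 2 + pent 3 (2 * m))%N.
    by apply: double_inj; rewrite doubleD double_pent /n; nia.
  rewrite exprD; apply: eqpmodMl.
  (* The term j = 2m+1 is zero, j = 2m is the boundary term, and the rest is opposite to itself. *)
  rewrite psum_beyond ?psum_edge; try (rewrite /n; lia).
  rewrite -signr_odd oddM expr0 mul1r -[X in eqpmod _ _ X]add0r.
  apply: eqpmodD (eqpmod_refl _ _); apply: psum_self_reflect => //.
    by lia.
  by rewrite /n; lia.
have S2 : eqpmod ('Phi_n ^+ 2) ('X^1 * psum 2 (2 * m).+2 (2 * n))
    (m.+1%:R * ('X^n - 1)).
  have le_n : (2 * n <= 3 * (2 * m).+2)%N by rewrite /n; lia.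
  (* The coefficient m + 1 is n - (2m+1), from q^(n^2) - q^(n(2m+1)). *)
  apply: (eqpmod_expXn_diff (a := n) n_gt0 _ S3); last by rewrite /n; lia.
  by rewrite addrC; apply: psum_central.
apply: eqpmodB S3.
have := @sum_qcatalan_mod n 1 (2 * m).+1 m.+1 (3 * m ^ 2 + 4 * m + 1) n_gt0.
rewrite -[(-1) ^+ _]signr_odd /= oddM /= expr1 mulN1r; apply => //.
- by rewrite /n; lia.
by apply: double_inj; rewrite double_pent /n; nia.
Qed.

(** Now P_2 reduces to its boundary term and P_1 is exchanged with P_3, with w = 2 and the even L =
    2m, hence the positive sign. *)
Lemma sum_qcatalan_1mod3 m (n := (3 * m + 1)%N) :
  eqpmod ('Phi_n ^+ 2) (\sum_(k < n) 'X^k * qcatalan k)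
    ('X^(3 * m ^ 2 + 2 * m) - m%:R * ('X^n - 1)).
Proof.
have n_gt0 : (0 < n)%N by rewrite /n; lia.
rewrite (@sum_qcatalan (2 * m).+1); [|rewrite /n; lia|by []].
have S2 : eqpmod ('Phi_n ^+ 2)
    ('X * psum 2 (2 * m).+1 (2 * n)) 'X^(n * (2 * m + 1)).
  have -> : (n * (2 * m + 1) = (pent 2 (2 * m)).+1)%N.
    by apply: double_inj; rewrite doubleS double_pent /n; nia.
  rewrite ['X^(_.+1)]exprS; apply: eqpmodMl.
  rewrite psum_edge; last by rewrite /n; lia.
  rewrite -signr_odd oddM expr0 mul1r -[X in eqpmod _ _ X]add0r.
  apply: eqpmodD (eqpmod_refl _ _); apply: psum_self_reflect => //.
    by lia.
  by rewrite /n; lia.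
have S3 : eqpmod ('Phi_n ^+ 2) ('X^2 * psum 3 (2 * m).+1 (2 * n))
    (m%:R * ('X^n - 1)).
  apply: (eqpmod_expXn_diff (a := n) n_gt0 _ S2).
    by apply: psum_central => //; rewrite /n; lia.
  by rewrite /n; lia.
apply: eqpmodB (S3).
have := @sum_qcatalan_mod n 2 (2 * m) m (3 * m ^ 2 + 2 * m) n_gt0.
rewrite -[(-1) ^+ _]signr_odd /= oddM /= expr0 mul1r; apply => //.
- by rewrite /n; lia.
by apply: double_inj; rewrite double_pent /n; nia.
Qed.

Theorem theorem1p1 (n : nat) (n_gt0 : (0 < n)%N) :
  ((n = 2 %[mod 3])%N ->
     eqpmod ('Phi_n ^+ 2)
       (\sum_(k < n) 'X^k * qcatalan k)
       (- 'X^((n ^ 2 - 1) %/ 3)%N - 'X^((n * (2 * n - 1)) %/ 3)%N)) /\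
  ((n = 1 %[mod 3])%N ->
     eqpmod ('Phi_n ^+ 2)
       (\sum_(k < n) 'X^k * qcatalan k)
       ('X^((n ^ 2 - 1) %/ 3)%N - ((n - 1) %/ 3)%N%:R * ('X^n - 1))).
Proof.
split=> En; have [m Em] : exists m, (n = 3 * m + n %% 3)%N
  by [exists (n %/ 3)%N; rewrite mulnC -divn_eq].
  rewrite En in Em; rewrite {}Em.
  have := sum_qcatalan_2mod3 m; set N := (3 * m + 2)%N.
  have -> : ((N ^ 2 - 1) %/ 3 = 3 * m ^ 2 + 4 * m + 1)%N by rewrite /N; nia.
  have -> // : ((N * (2 * N - 1)) %/ 3 = N * (2 * m + 1))%N by rewrite /N; nia.
rewrite En in Em; rewrite {}Em.
have := sum_qcatalan_1mod3 m; set N := (3 * m + 1)%N.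
have -> : ((N ^ 2 - 1) %/ 3 = 3 * m ^ 2 + 2 * m)%N by rewrite /N; nia.
by have -> : ((N - 1) %/ 3 = m)%N by rewrite /N; lia.
Qed.
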